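(* Let $f\colon X\to A$ be a morphism in the category $\mathbf{BHp}$ of bounded hoops. Then $f$ is coextensive (in $\mathbf{BHp}$) if and only if for any weakly complementary central elements $e_1$ and $e_2$ of $X$, if $e_1\vee e_2=1$ in $X$ then $f(e_1)\vee f(e_2)=1$ in $A$.
   Context: A hoop is an algebra $(H,\cdot,\to,1)$ such that $(H,\cdot,1)$ is a commutative monoid and, for all $x,y,z\in H$: $x\to x=1$; $x\to(y\to z)=(x\cdot y)\to z$; $(x\to y)\cdot x=(y\to x)\cdot y$. The natural order of a hoop is the partial order $x\leqslant y\iff x\to y=1$. A hoop is bounded if it has a bottom element $0$ for this order. $\mathbf{BHp}$ is the category (variety) of bounded hoops, with morphisms the maps preserving $\cdot,\to,1$ and $0$. Let $\mathbf{2}=\{0,1\}$ be the two-element bounded hoop. Elements $e_1,e_2$ of a bounded hoop $X$ are weakly complementary central elements if there is a morphism $g\colon\mathbf{2}\times\mathbf{2}\to X$ in $\mathbf{BHp}$ with $e_1=g(1,0)$ and $e_2=g(0,1)$. Joins are not assumed to exist in general: $e_1\vee e_2=1$ means that the join of $e_1$ and $e_2$ in the natural order exists and equals $1$. A morphism $f\colon A\to X$ in a category with finite products is coextensive if: (1) $f$ admits pushouts along the two projections of every product diagram $A_1\leftarrow A\to A_2$, and the resulting pushouts $X_1\leftarrow X\to X_2$ form a product diagram; and (2) for every product diagram $A_1\leftarrow A\to A_2$, every product diagram $X_1\leftarrow X\to X_2$, and all morphisms $A_1\to X_1$, $A_2\to X_2$ which together with $f$ make the two evident squares commute, both squares are pushouts.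 *)

(* Defs.v *)
From mathcomp Require Import ssreflect ssrfun ssrbool.
From Stdlib Require Import FunctionalExtensionality ProofIrrelevance.

Set Implicit Arguments.
Unset Strict Implicit.
Unset Printing Implicit Defensive.

Record category := Category {
  obj :> Type;
  hom : obj -> obj -> Type;
  idm : forall A, hom A A;
  compm : forall A B C, hom B C -> hom A B -> hom A C;
  compm1 : forall A B (f : hom A B), compm f (idm A) = f;
  comp1m : forall A B (f : hom A B), compm (idm B) f = f;
  compmA : forall A B C D (h : hom C D) (g : hom B C) (f : hom A B),
    compm h (compm g f) = compm (compm h g) f
}.

Arguments hom {_} _ _.
Arguments idm {_} _.

Notation "g \oc f" := (compm g f) (at level 50, left associativity).

Definition is_product (C : category) (A A1 A2 : C)
    (p1 : hom A A1) (p2 : hom A A2) : Prop :=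
  forall (Z : C) (u1 : hom Z A1) (u2 : hom Z A2),
    exists! u : hom Z A, p1 \oc u = u1 /\ p2 \oc u = u2.

(* The square is  A --f--> B
                  |g       |h
                  C --k--> P  *)
Definition is_pushout (T : category) (A B C P : T)
    (f : hom A B) (g : hom A C) (h : hom B P) (k : hom C P) : Prop :=
  h \oc f = k \oc g /\
  forall (Q : T) (h' : hom B Q) (k' : hom C Q), h' \oc f = k' \oc g ->
    exists! u : hom P Q, u \oc h = h' /\ u \oc k = k'.

Definition has_pushout (T : category) (A B C : T)
    (f : hom A B) (g : hom A C) : Prop :=
  exists (P : T) (h : hom B P) (k : hom C P), is_pushout f g h k.

(* Pushouts are unique up to isomorphism, so the first condition quantifies
   over all choices of pushouts once these are known to exist. *)
Definition coextensive (T : category) (A X : T) (f : hom A X) : Prop :=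
  (forall (A1 A2 : T) (p1 : hom A A1) (p2 : hom A A2), is_product p1 p2 ->
     has_pushout f p1 /\ has_pushout f p2 /\
     forall (X1 X2 : T) (q1 : hom X X1) (q2 : hom X X2)
       (f1 : hom A1 X1) (f2 : hom A2 X2),
       is_pushout f p1 q1 f1 -> is_pushout f p2 q2 f2 -> is_product q1 q2) /\
  (forall (A1 A2 X1 X2 : T) (p1 : hom A A1) (p2 : hom A A2)
     (q1 : hom X X1) (q2 : hom X X2) (f1 : hom A1 X1) (f2 : hom A2 X2),
     is_product p1 p2 -> is_product q1 q2 ->
     q1 \oc f = f1 \oc p1 -> q2 \oc f = f2 \oc p2 ->
     is_pushout f p1 q1 f1 /\ is_pushout f p2 q2 f2).

Record hoop := Hoop {
  carrier :> Type;
  hmul : carrier -> carrier -> carrier;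
  himp : carrier -> carrier -> carrier;
  hone : carrier;
  hmulA : associative hmul;
  hmulC : commutative hmul;
  hmul1 : left_id hone hmul;
  himpxx : forall x, himp x x = hone;
  himpA : forall x y z, himp x (himp y z) = himp (hmul x y) z;
  himpM : forall x y, hmul (himp x y) x = hmul (himp y x) y
}.

Arguments hone {_}.

Definition hle (H : hoop) (x y : H) : Prop := himp x y = hone.

Definition is_join (H : hoop) (x y j : H) : Prop :=
  hle x j /\ hle y j /\ forall z : H, hle x z -> hle y z -> hle j z.

Record bhoop := BHoop {
  bhoop_hoop :> hoop;
  hzero : bhoop_hoop;
  hle0 : forall x : bhoop_hoop, hle hzero x
}.

Arguments hzero {_}.

Record bhoop_hom (X Y : bhoop) := BHoopHom {
  bhoop_fun :> X -> Y;
  bhoop_homM : forall x y, bhoop_fun (hmul x y) = hmul (bhoop_fun x) (bhoop_fun y);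
  bhoop_homI : forall x y, bhoop_fun (himp x y) = himp (bhoop_fun x) (bhoop_fun y);
  bhoop_hom1 : bhoop_fun hone = hone;
  bhoop_hom0 : bhoop_fun hzero = hzero
}.

Lemma bhoop_hom_ext (X Y : bhoop) (f g : bhoop_hom X Y) : f =1 g -> f = g.
Proof.
case: f g => [f fM fI f1 f0] [g gM gI g1 g0] /= /functional_extensionality fg.
by subst g; congr BHoopHom; apply: proof_irrelevance.
Qed.

Definition bhoop_id (X : bhoop) : bhoop_hom X X :=
  @BHoopHom X X (fun x => x) (fun _ _ => erefl) (fun _ _ => erefl) erefl erefl.

Definition bhoop_comp (X Y Z : bhoop) (g : bhoop_hom Y Z) (f : bhoop_hom X Y) :
  bhoop_hom X Z.
Proof.
exists (fun x => g (f x)).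
- by move=> x y; rewrite !bhoop_homM.
- by move=> x y; rewrite !bhoop_homI.
- by rewrite !bhoop_hom1.
- by rewrite !bhoop_hom0.
Defined.

Definition BHp : category.
Proof.
exists bhoop bhoop_hom bhoop_id bhoop_comp.
- by move=> X Y f; apply: bhoop_hom_ext.
- by move=> X Y f; apply: bhoop_hom_ext.
- by move=> X Y Z W h g f; apply: bhoop_hom_ext.
Defined.

Definition two_hoop : hoop.
Proof.
exists bool andb implb true.
- exact: andbA.
- exact: andbC.
- exact: andTb.
- by case.
- by case; case; case.
- by case; case.
Defined.

Definition two : bhoop := @BHoop two_hoop false (fun _ => erefl).

Definition prod_hoop (X Y : hoop) : hoop.
Proof.
exists (X * Y)%type
  (fun u v => (hmul u.1 v.1, hmul u.2 v.2))
  (fun u v => (himp u.1 v.1, himp u.2 v.2))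
  (hone, hone).
- by move=> [x1 x2] [y1 y2] [z1 z2]; rewrite /= !hmulA.
- by move=> [x1 x2] [y1 y2]; congr pair; apply: hmulC.
- by move=> [x1 x2]; rewrite /= !hmul1.
- by move=> [x1 x2]; rewrite /= !himpxx.
- by move=> [x1 x2] [y1 y2] [z1 z2]; rewrite /= !himpA.
- by move=> [x1 x2] [y1 y2]; congr pair; apply: himpM.
Defined.

Definition prod_bhoop (X Y : bhoop) : bhoop.
Proof.
exists (prod_hoop X Y) (hzero, hzero).
by move=> [x1 x2]; rewrite /hle /=; congr pair; apply: hle0.
Defined.

Definition weakly_complementary_central (X : bhoop) (e1 e2 : X) : Prop :=
  exists g : bhoop_hom (prod_bhoop two two) X,
    e1 = g (true, false) /\ e2 = g (false, true).

(* Main.v *)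
(* If [X] is a product of [X1] and [X2], let [e1] and [e2] be the elements of
   [X] corresponding to (1,0) and (0,1).  The projection to [X1] identifies x
   and y exactly when e1 x = e1 y, that is, it is the quotient by the filter
   above [e1]; so its pushout along [f] is the quotient of [A] by the filter
   above [f e1].  Given weakly complementary central elements d1 and d2 of [A],
   the map from [A] to the product of its quotients by them is always
   surjective, (d1 -> x)(d2 -> y) being a preimage of the class of (x, y), and
   it is injective if and only if d1 \/ d2 = 1.  The second condition of
   coextensivity holds for every [f], since in a commuting diagram of products
   the elements [f e1] and [f e2] are those which define the decomposition of
   [A]. *)

From mathcomp Require Import ssreflect ssrfun ssrbool.
From Stdlib Require Import ProofIrrelevance.
Require Import Defs.

Set Implicit Arguments.
Unset Strict Implicit.
Unset Printing Implicit Defensive.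

(** * Order and residuation in hoops *)

Section HoopTheory.
Variable H : hoop.
Implicit Types x y z e : H.

Lemma hmulr1 x : hmul x hone = x.
Proof. by rewrite hmulC hmul1. Qed.

Lemma himp_antisym x y : himp x y = hone -> himp y x = hone -> x = y.
Proof. by move=> xy yx; have := himpM x y; rewrite xy yx !hmul1. Qed.

Lemma himp1x x : himp hone x = x.
Proof.
apply: himp_antisym; last by rewrite himpA hmulr1 himpxx.
by rewrite -[himp hone x in LHS]hmulr1 -himpA himpxx.
Qed.

(* With q = x -> 1: q x = x, hence q = x -> (q -> q) = x q -> q = x -> q, and
   therefore q = x -> q = q x -> q = q -> (x -> q) = q -> q = 1. *)
Lemma himpx1 x : himp x hone = hone.
Proof.
move Eq: (himp x hone) => q.
have qx : hmul q x = x by rewrite -Eq himpM himp1x hmulr1.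
have xq : himp x q = q by rewrite -[RHS]Eq -(himpxx q) himpA [hmul x q]hmulC qx.
by rewrite -xq -[X in himp X q]qx -himpA xq himpxx.
Qed.

Lemma hle_mull x y : hle (hmul x y) y.
Proof. by rewrite /hle -himpA himpxx himpx1. Qed.

Lemma hle_trans x y z : hle x y -> hle y z -> hle x z.
Proof.
rewrite /hle => xy yz.
(* By divisibility [x] is [(y -> x) y], so residuation brings out [y -> z]. *)
by rewrite -[x]hmul1 -xy himpM -himpA yz himpx1.
Qed.

Lemma hle_mul2l z x y : hle x y -> hle (hmul z x) (hmul z y).
Proof.
move=> xy; rewrite /hle hmulC -himpA.
apply: (hle_trans xy); rewrite /hle himpA hmulC; exact: himpxx.
Qed.

Lemma hmul_himp_le x y : hle (hmul (himp x y) x) y.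
Proof. by rewrite /hle -himpA himpxx. Qed.

(** As [e = e e], one copy of [e] stays outside while the other moves under the implication. This
    makes [e (x -> y)] a residual on the elements fixed by [e]. *)
Lemma hmul_idem_himp e x y : hmul e e = e ->
  hmul e (himp x (hmul e y)) = hmul e (himp x y).
Proof.
move=> ee; apply: himp_antisym.
  apply: hle_mul2l; rewrite /hle himpA.
  exact: hle_trans (hmul_himp_le _ _) (hle_mull _ _).
rewrite -{1}ee -hmulA; apply: hle_mul2l; rewrite /hle himpA -hmulA.
exact/hle_mul2l/hmul_himp_le.
Qed.

Lemma hmul_idem_himpl e x : hmul e e = e -> hmul e (himp e x) = hmul e x.
Proof.
move=> ee; apply: himp_antisym.
  rewrite -{1}ee -hmulA; apply: hle_mul2l.
  by rewrite hmulC; apply: hmul_himp_le.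
by apply: hle_mul2l; rewrite /hle himpA hmulC; apply: hle_mull.
Qed.

End HoopTheory.

Lemma hmul0 (A : bhoop) (x : A) : hmul hzero x = hzero.
Proof. by apply: himp_antisym (hle0 _); rewrite hmulC; apply: hle_mull. Qed.

(** * Quotients by idempotents and their pushouts *)

Section Quotient.
Variables (A : bhoop) (e : A).
Hypothesis ee : hmul e e = e.

(* Each class of the quotient by the filter above [e] has exactly one element
   fixed by multiplication by [e]. *)
Let T := {a : A | hmul e a = a}.

Lemma quot_inj (a b : T) : proj1_sig a = proj1_sig b -> a = b.
Proof.
case: a b => [a ea] [b eb] /= ab; subst b.
by congr exist; apply: proof_irrelevance.
Qed.

Definition quot_proj (a : A) : T.
Proof. by exists (hmul e a); rewrite hmulA ee. Defined.

Definition quot_mul (a b : T) : T.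
Proof.
exists (hmul (proj1_sig a) (proj1_sig b)).
by rewrite hmulA (proj2_sig a).
Defined.

Definition quot_hoop : hoop.
Proof.
exists T quot_mul (fun a b => quot_proj (himp (proj1_sig a) (proj1_sig b)))
  (quot_proj hone).
- by move=> a b c; apply: quot_inj; rewrite /= hmulA.
- by move=> a b; apply: quot_inj; rewrite /= hmulC.
- by case=> a ea; apply: quot_inj; rewrite /= hmulr1.
- by move=> a; apply: quot_inj; rewrite /= himpxx.
- by move=> a b c; apply: quot_inj; rewrite /= hmul_idem_himp // himpA.
- by move=> a b; apply: quot_inj; rewrite /= -!hmulA himpM.
Defined.

Definition quot_bhoop : bhoop.
Proof.
exists quot_hoop (quot_proj hzero).
move=> a; apply: quot_inj => /=; congr (hmul e _).
rewrite hmulC hmul0; exact: hle0.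
Defined.

Definition quot_hom : bhoop_hom A quot_bhoop.
Proof.
exists quot_proj => //.
- by move=> x y; apply: quot_inj; rewrite /= [hmul e x]hmulC -!hmulA
    [hmul e (hmul e y)]hmulA ee !hmulA [hmul e x]hmulC.
- move=> x y; apply: quot_inj => /=.
  by rewrite hmul_idem_himp // -[himp (hmul e x) y]himpA hmul_idem_himpl.
Defined.

End Quotient.

(** Up to isomorphism, [q] is the quotient by the filter above [e]; this form also fits abstract
    projections and pushouts. The section [s] is a mere map choosing representatives. *)
Definition split_quotient (X B : bhoop) (e : X) (q : bhoop_hom X B)
    (s : B -> X) : Prop :=
  [/\ cancel s q, q e = hone & forall x y, q x = q y -> hmul e x = hmul e y].

Lemma quot_hom_split (A : bhoop) (e : A) (ee : hmul e e = e) :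
  split_quotient e (quot_hom ee) (@proj1_sig _ _).
Proof.
split.
- by move=> [a ea]; apply: quot_inj.
- by apply: quot_inj; rewrite /= hmulr1.
- by move=> x y /(congr1 (@proj1_sig _ _)).
Qed.

(** The factorization is [h] after [s]: since [h e = 1], [h] identifies all that [q] does, so the
    choice of representatives does not matter. *)
Lemma split_quotient_factor (X B R : bhoop) (e : X) (q : bhoop_hom X B)
    (s : B -> X) (h : bhoop_hom X R) :
  split_quotient e q s -> h e = hone ->
  exists u : bhoop_hom B R, forall x, u (q x) = h x.
Proof.
case=> sK q1 qe h1.
have hq x y : q x = q y -> h x = h y.
  by move/qe/(congr1 h); rewrite !bhoop_homM h1 !hmul1.
have uM x y : h (s (hmul x y)) = hmul (h (s x)) (h (s y)).
  by rewrite -bhoop_homM; apply: hq; rewrite bhoop_homM !sK.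
have uI x y : h (s (himp x y)) = himp (h (s x)) (h (s y)).
  by rewrite -bhoop_homI; apply: hq; rewrite bhoop_homI !sK.
have u1 : h (s hone) = hone.
  by rewrite -(bhoop_hom1 h); apply: hq; rewrite sK bhoop_hom1.
have u0 : h (s hzero) = hzero.
  by rewrite -(bhoop_hom0 h); apply: hq; rewrite sK bhoop_hom0.
by exists (BHoopHom uM uI u1 u0) => x; apply: hq; rewrite sK.
Qed.

Lemma bhoop_hom_eqfun (X Y : bhoop) (f g : bhoop_hom X Y) : f = g -> f =1 g.
Proof. by move->. Qed.

Lemma split_quotient_pushout (X A B C : bhoop) (f : bhoop_hom X A) (e : X)
    (p : bhoop_hom X B) (s : B -> X) (q : bhoop_hom A C) (t : C -> A)
    (k : bhoop_hom B C) :
  split_quotient e p s -> split_quotient (f e) q t ->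
  (forall x, q (f x) = k (p x)) ->
  @is_pushout BHp X A B C f p q k.
Proof.
move=> ps qt qk; split; first exact: bhoop_hom_ext.
move=> R h l /bhoop_hom_eqfun /= hl.
(* Any cocone kills [f e], because [p] already sends [e] to 1. *)
have h1 : h (f e) = hone by rewrite hl; case: ps => _ -> _; apply: bhoop_hom1.
have [u uE] := split_quotient_factor qt h1.
exists u; split; first split.
- exact: bhoop_hom_ext.
- apply: bhoop_hom_ext => b /=; case: ps => sK _ _.
  by rewrite -[b]sK -qk uE hl.
- move=> v [/bhoop_hom_eqfun /= vq _]; apply: bhoop_hom_ext => c.
  by case: qt => tK _ _; rewrite -[c]tK uE -vq.
Qed.

Lemma split_quotient_has_pushout (X A B : bhoop) (f : bhoop_hom X A) (e : X)
    (p : bhoop_hom X B) (s : B -> X) :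
  split_quotient e p s -> hmul e e = e ->
  exists (C : bhoop) (q : bhoop_hom A C) (t : C -> A) (k : bhoop_hom B C),
    split_quotient (f e) q t /\ @is_pushout BHp X A B C f p q k.
Proof.
move=> ps ee.
have fee : hmul (f e) (f e) = f e by rewrite -bhoop_homM ee.
have qt := quot_hom_split fee.
have h1 : (bhoop_comp (quot_hom fee) f) e = hone by case: qt.
have [k kE] := split_quotient_factor ps h1.
exists (quot_bhoop fee), (quot_hom fee), (@proj1_sig _ _), k; split=> //.
by apply: split_quotient_pushout ps qt _ => x; rewrite kE.
Qed.

Lemma pushout_split_quotient (X A B C : bhoop) (f : bhoop_hom X A) (e : X)
    (p : bhoop_hom X B) (s : B -> X) (q : bhoop_hom A C) (k : bhoop_hom B C) :
  split_quotient e p s -> hmul e e = e ->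
  @is_pushout BHp X A B C f p q k ->
  exists t : C -> A, split_quotient (f e) q t.
Proof.
move=> ps ee [qk qU].
have [D [r [t [l [[tK re rE] [rl rU]]]]]] :=
  split_quotient_has_pushout f ps ee.
have [i [[/bhoop_hom_eqfun /= iq /bhoop_hom_eqfun /= ik] _]] := rU C q k qk.
have [j [[/bhoop_hom_eqfun /= jq /bhoop_hom_eqfun /= jk] _]] := qU D r l rl.
have [w [_ wU]] := qU C q k qk.
(* Here [i] and [j] compare the given pushout [C] with the explicit one [D]; the representatives are
   carried over along them. *)
have ij : forall c, i (j c) = c.
  have w1 : w = bhoop_comp i j.
    by apply: wU; split; apply: bhoop_hom_ext => x /=; rewrite ?jq ?jk.
  have w2 : w = bhoop_id C by apply: wU; split; apply: bhoop_hom_ext.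
  by move=> c; have := bhoop_hom_eqfun (etrans (esym w1) w2) c.
exists (fun c => t (j c)); split.
- by move=> c; rewrite -iq tK ij.
- by rewrite -iq re bhoop_hom1.
- by move=> x y xy; apply: rE; rewrite -!jq xy.
Qed.

(** * Product diagrams and central elements *)

Definition bhoop_fst (B1 B2 : bhoop) : bhoop_hom (prod_bhoop B1 B2) B1 :=
  @BHoopHom (prod_bhoop B1 B2) B1 fst
    (fun _ _ => erefl) (fun _ _ => erefl) erefl erefl.

Definition bhoop_snd (B1 B2 : bhoop) : bhoop_hom (prod_bhoop B1 B2) B2 :=
  @BHoopHom (prod_bhoop B1 B2) B2 snd
    (fun _ _ => erefl) (fun _ _ => erefl) erefl erefl.

Definition bhoop_pair (X B1 B2 : bhoop) (p1 : bhoop_hom X B1)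
  (p2 : bhoop_hom X B2) : bhoop_hom X (prod_bhoop B1 B2).
Proof.
exists (fun x => (p1 x, p2 x)) => [x y|x y||].
- by rewrite !bhoop_homM.
- by rewrite !bhoop_homI.
- by rewrite !bhoop_hom1.
- by rewrite !bhoop_hom0.
Defined.

Definition two_hom (B : bhoop) : bhoop_hom two B.
Proof.
exists (fun b : two => if b then hone else hzero) => //.
- by case=> y; rewrite ?hmul1 ?hmul0.
- by case; case; rewrite /= ?himp1x ?himpxx ?(hle0 _).
Defined.

Lemma product_inverse (X B1 B2 : bhoop) (p1 : bhoop_hom X B1)
    (p2 : bhoop_hom X B2) :
  @is_product BHp X B1 B2 p1 p2 ->
  exists u : bhoop_hom (prod_bhoop B1 B2) X,
    [/\ forall z, p1 (u z) = z.1, forall z, p2 (u z) = z.2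
      & forall x, u (p1 x, p2 x) = x].
Proof.
move=> pP.
have [u [[/bhoop_hom_eqfun /= u1 /bhoop_hom_eqfun /= u2] _]] := 
  pP (prod_bhoop B1 B2) (bhoop_fst B1 B2) (bhoop_snd B1 B2).
exists u; split=> // x.
have [w [_ wU]] := pP X p1 p2.
have w1 : w = bhoop_comp u (bhoop_pair p1 p2).
  by apply: wU; split; apply: bhoop_hom_ext => y /=; rewrite ?u1 ?u2.
have w2 : w = bhoop_id X by apply: wU; split; apply: bhoop_hom_ext.
by have := bhoop_hom_eqfun (etrans (esym w1) w2) x.
Qed.

Lemma product_central_elements (X B1 B2 : bhoop) (p1 : bhoop_hom X B1)
    (p2 : bhoop_hom X B2) :
  @is_product BHp X B1 B2 p1 p2 ->
  exists e1 e2 : X, [/\ weakly_complementary_central e1 e2,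
    is_join e1 e2 hone,
    p1 e1 = hone /\ p2 e1 = hzero,
    p1 e2 = hzero /\ p2 e2 = hone
    & (forall x y, p1 x = p1 y -> p2 x = p2 y -> x = y)
      /\ exists s1 s2, split_quotient e1 p1 s1 /\ split_quotient e2 p2 s2].
Proof.
move=> /product_inverse [u [u1 u2 uK]].
have p_inj x y : p1 x = p1 y -> p2 x = p2 y -> x = y.
  by move=> xy1 xy2; rewrite -(uK x) xy1 xy2 uK.
pose g := bhoop_pair (bhoop_comp (two_hom B1) (bhoop_fst two two))
                     (bhoop_comp (two_hom B2) (bhoop_snd two two)).
exists (u (hone, hzero)), (u (hzero, hone)); split; rewrite ?u1 ?u2 //.
- by exists (bhoop_comp u g).
- split; [exact: himpx1 | split; [exact: himpx1 | move=> z]].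
  move=> /(congr1 p1); rewrite bhoop_homI bhoop_hom1 u1 /= himp1x => z1.
  move=> /(congr1 p2); rewrite bhoop_homI bhoop_hom1 u2 /= himp1x => z2.
  by rewrite /hle himp1x; apply: p_inj; rewrite ?z1 ?z2 !bhoop_hom1.
(* Multiplying by [e1] replaces the second coordinate by 0, so [e1 x] depends on [p1 x] only;
   likewise for [e2]. *)
- split=> //; exists (fun b => u (b, hzero)), (fun b => u (hzero, b)).
  by split; split=> [b||x y xy]; rewrite ?u1 ?u2 //; apply: p_inj;
    rewrite !bhoop_homM ?u1 ?u2 ?xy //= !hmul0.
Qed.

Lemma wcc_mul (X : bhoop) (e1 e2 : X) : weakly_complementary_central e1 e2 ->
  [/\ hmul e1 e1 = e1, hmul e2 e2 = e2 & hmul e1 e2 = hzero].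
Proof. by case=> g [-> ->]; rewrite -!bhoop_homM -(bhoop_hom0 g). Qed.

Lemma split_quotient_product (X B1 B2 : bhoop) (e1 e2 : X)
    (p1 : bhoop_hom X B1) (s1 : B1 -> X) (p2 : bhoop_hom X B2) (s2 : B2 -> X) :
  hmul e1 e2 = hzero -> is_join e1 e2 hone ->
  split_quotient e1 p1 s1 -> split_quotient e2 p2 s2 ->
  @is_product BHp X B1 B2 p1 p2.
Proof.
move=> e12 [_ [_ e_join]] [s1K pe1 qe1] [s2K pe2 qe2] Z u1 u2.
(* From [e1 x = e1 y <= y] follows [e1 <= x -> y], and likewise for [e2]; the join being 1 then
   gives [x <= y]. *)
have p_le x y : p1 x = p1 y -> p2 x = p2 y -> himp x y = hone.
  move=> /qe1 xy1 /qe2 xy2; rewrite -[LHS]himp1x.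
  by apply: e_join; rewrite /hle himpA ?xy1 ?xy2; apply: hle_mull.
have p_inj x y : p1 x = p1 y -> p2 x = p2 y -> x = y.
  by move=> xy1 xy2; apply: himp_antisym; apply: p_le.
have p12 : p1 e2 = hzero.
  by rewrite -(hmul1 (p1 e2)) -pe1 -bhoop_homM e12 bhoop_hom0.
have p21 : p2 e1 = hzero.
  by rewrite -(hmulr1 (p2 e1)) -pe2 -bhoop_homM e12 bhoop_hom0.
pose w z := hmul (himp e1 (s1 (u1 z))) (himp e2 (s2 (u2 z))).
have w1 z : p1 (w z) = u1 z.
  by rewrite bhoop_homM !bhoop_homI pe1 p12 s1K (hle0 _) himp1x hmulr1.
have w2 z : p2 (w z) = u2 z.
  by rewrite bhoop_homM !bhoop_homI pe2 p21 s2K (hle0 _) himp1x hmul1.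
(* The operations are preserved because they are after each of the jointly injective [p1] and
   [p2]. *)
have wM x y : w (hmul x y) = hmul (w x) (w y).
  by apply: p_inj; rewrite bhoop_homM ?w1 ?w2 bhoop_homM.
have wI x y : w (himp x y) = himp (w x) (w y).
  by apply: p_inj; rewrite bhoop_homI ?w1 ?w2 bhoop_homI.
have wone : w hone = hone by apply: p_inj; rewrite ?w1 ?w2 !bhoop_hom1.
have w0 : w hzero = hzero by apply: p_inj; rewrite ?w1 ?w2 !bhoop_hom0.
exists (BHoopHom wM wI wone w0); split.
  by split; apply: bhoop_hom_ext => z /=; rewrite ?w1 ?w2.
move=> v [/bhoop_hom_eqfun /= v1 /bhoop_hom_eqfun /= v2]; apply: bhoop_hom_ext => z.
by apply: p_inj; rewrite ?w1 ?w2 ?v1 ?v2.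
Qed.

Theorem proposition2p2 (X A : bhoop) (f : bhoop_hom X A) :
  @coextensive BHp X A f <->
  (forall e1 e2 : X, weakly_complementary_central e1 e2 ->
     is_join e1 e2 hone -> is_join (f e1) (f e2) hone).
Proof.
split.
  move=> [f_push _] e1 e2 /wcc_mul [e11 e22 e12] e_join.
  have qt1 := quot_hom_split e11; have qt2 := quot_hom_split e22.
  have [_ [_ f_prod]] := f_push _ _ (quot_hom e11) (quot_hom e22)
    (split_quotient_product e12 e_join qt1 qt2).
  have [C1 [r1 [t1 [k1 [rt1 po1]]]]] := split_quotient_has_pushout f qt1 e11.
  have [C2 [r2 [t2 [k2 [rt2 po2]]]]] := split_quotient_has_pushout f qt2 e22.
  have [u [_ _ uK]] := product_inverse (f_prod _ _ _ _ _ _ po1 po2).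
  (* An upper bound [z] of [f e1] and [f e2] is sent to 1 by both [r1] and [r2], hence equals 1 by
     [uK]. *)
  split; [exact: himpx1 | split; [exact: himpx1 | move=> z z1 z2]].
  case: rt1 rt2 => [_ r1e _] [_ r2e _].
  have := congr1 r1 z1; have := congr1 r2 z2.
  rewrite !bhoop_homI !bhoop_hom1 r1e r2e !himp1x => r2z r1z.
  by rewrite /hle himp1x -(uK z) r1z r2z -(bhoop_hom1 r1) -(bhoop_hom1 r2) uK.
move=> f_join; split.
  move=> X1 X2 p1 p2 pP.
  have [e1 [e2 [e_wcc e_join _ _ [_ [s1 [s2 [ps1 ps2]]]]]]] := product_central_elements pP.
  have [e11 e22 e12] := wcc_mul e_wcc.
  have [C1 [r1 [t1 [k1 [_ po1]]]]] := split_quotient_has_pushout f ps1 e11.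
  have [C2 [r2 [t2 [k2 [_ po2]]]]] := split_quotient_has_pushout f ps2 e22.
  split; first by exists C1, r1, k1.
  split; first by exists C2, r2, k2.
  move=> A1 A2 q1 q2 f1 f2.
  move=> /(pushout_split_quotient ps1 e11) [t1' qt1].
  move=> /(pushout_split_quotient ps2 e22) [t2' qt2].
  apply: split_quotient_product (f_join _ _ e_wcc e_join) qt1 qt2.
  by rewrite -bhoop_homM e12 bhoop_hom0.
move=> X1 X2 A1 A2 p1 p2 q1 q2 f1 f2 pP qP.
move=> /bhoop_hom_eqfun /= sq1 /bhoop_hom_eqfun /= sq2.
have [e1 [e2 [_ _ [pe11 pe21] [pe12 pe22] [_ [s1 [s2 [ps1 ps2]]]]]]] :=
  product_central_elements pP.
have [d1 [d2 [_ _ [qd11 qd21] [qd12 qd22] [q_inj [t1 [t2 [qt1 qt2]]]]]]] :=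
  product_central_elements qP.
(* The squares give [f e1] the coordinates [f1 1 = 1] and [f2 0 = 0], which are those of [d1]. *)
have fe1 : f e1 = d1.
  by apply: q_inj; rewrite ?sq1 ?sq2 ?pe11 ?pe21 ?bhoop_hom1 ?bhoop_hom0.
have fe2 : f e2 = d2.
  by apply: q_inj; rewrite ?sq1 ?sq2 ?pe12 ?pe22 ?bhoop_hom1 ?bhoop_hom0.
split.
  by apply: split_quotient_pushout ps1 _ sq1; rewrite fe1; exact: qt1.
by apply: split_quotient_pushout ps2 _ sq2; rewrite fe2; exact: qt2.
Qed.
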